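(* Let $X$ be a star Menger space. If $Y$ is a Lindelöf locally compact space, or more generally a Lindelöf locally $\sigma$-compact space, then the product $X\times Y$ is star Menger.
   Context: All spaces are assumed to be regular and $T_1$. For a family $\mathcal{U}$ of subsets of $X$ and $A\subseteq X$, $St(A,\mathcal{U})=\bigcup\{U\in\mathcal{U}:U\cap A\neq\emptyset\}$. A space $M$ is Menger if for every sequence $\{\mathcal{U}_n:n\in\omega\}$ of open covers of $M$ there are finite subcollections $\mathcal{V}_n\subseteq\mathcal{U}_n$ ($n\in\omega$) such that $\bigcup\{\mathcal{V}_n:n\in\omega\}$ is an open cover of $M$. A space $X$ is star Menger if for every open cover $\mathcal{U}$ of $X$ there is a subspace $M\subseteq X$ which is Menger and satisfies $St(M,\mathcal{U})=X$. A space $Y$ is locally compact (respectively, locally $\sigma$-compact) if every point $y\in Y$ has an open neighbourhood $V_y$ whose closure $\overline{V_y}$ is compact (respectively, $\sigma$-compact, i.e. a countable union of compact subspaces). *)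

(* Defs.v *)
From mathcomp Require Import all_boot.
From mathcomp Require Import all_classical topology.

Set Implicit Arguments.
Unset Strict Implicit.
Unset Printing Implicit Defensive.

Local Open Scope classical_set_scope.

Definition open_cover (T : topologicalType) (U : set (set T)) : Prop :=
  U `<=` open /\ \bigcup_(A in U) A = [set: T].

Definition star (T : Type) (A : set T) (U : set (set T)) : set T :=
  \bigcup_(B in [set B | U B /\ B `&` A !=set0]) B.

Definition menger_space (T : topologicalType) : Prop :=
  forall U : nat -> set (set T), (forall n, open_cover (U n)) ->
  exists V : nat -> set (set T),
    (forall n, V n `<=` U n /\ finite_set (V n)) /\
    open_cover (\bigcup_n V n).

(* The canonical topology of [set_type M] is the subspace topology; that of
   [subspace M] is not, since it also retains the points outside [M]. *)
Definition star_menger_space (T : topologicalType) : Prop :=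
  forall U : set (set T), open_cover U ->
  exists M : set T, menger_space (set_type M) /\ star M U = [set: T].

Definition lindelof_space (T : topologicalType) : Prop :=
  forall U : set (set T), open_cover U ->
  exists V : set (set T), V `<=` U /\ countable V /\ open_cover V.

Definition sigma_compact (T : topologicalType) (A : set T) : Prop :=
  exists K : nat -> set T, (forall n, compact (K n)) /\ A = \bigcup_n K n.

Definition locally_sigma_compact (T : topologicalType) : Prop :=
  forall y : T, exists V : set T, open_nbhs y V /\ sigma_compact (closure V).

(* The library's [locally_compact] asks for a closed compact neighbourhood of
   every point; this is the same as an open neighbourhood whose closure is
   compact, without any separation axiom. *)
Lemma locally_compactP (T : topologicalType) :
  locally_compact [set: T] <->
  forall y : T, exists V : set T, open_nbhs y V /\ compact (closure V).
Proof.
split=> lcT y.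
  have [B yB [cB clB]] := lcT y I.
  have {yB} : nbhs y B by apply: (@filterS _ (nbhs y) _ _ _ _ yB) => z; exact.
  rewrite nbhsE => -[V yV VB]; exists V; split=> //.
  by rewrite -precompactE; exists B.
move=> _; have [V [yV cV]] := lcT y; exists (closure V); last first.
  by split=> //; exact: closed_closure.
apply: filterS (open_nbhs_nbhs yV) => z Vz _; exact: subset_closure.
Qed.

(* Main.v *)
Require Import Defs.
From mathcomp Require Import all_boot.
From mathcomp Require Import all_classical topology.

(** A Lindelof locally sigma-compact space is a union of countably many
    compact sets [K n].  Given an open cover [U] of [X * Y], the tube lemma
    yields, for each [n], an open cover of [X] by sets [W] such that every
    [W `*` [set y]] with [y] in [K n] lies in a single member of [U]; if [M n]
    is a Menger set whose star with respect to that cover is [X], then the star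
    of [M n `*` K n] with respect to [U] contains [setT `*` K n].  The product
    of a Menger set and a compact set is Menger, and so is a countable union of
    Menger sets, so the union of the [M n `*` K n] is as required. *)

Local Open Scope classical_set_scope.

(** Covers consist of open sets of the ambient space, so that products and unions of subsets can be
    treated without subspace types. *)
Definition menger_set {T : topologicalType} (A : set T) : Prop :=
  forall U : nat -> set (set T),
    (forall n, U n `<=` open /\ A `<=` \bigcup_(B in U n) B) ->
  exists V : nat -> set (set T),
    (forall n, V n `<=` U n /\ finite_set (V n)) /\
    A `<=` \bigcup_n \bigcup_(B in V n) B.

Lemma menger_setP (T : topologicalType) (A : set T) :
  menger_space (set_type A) <-> menger_set A.
Proof.
have valA (a : set_type A) : A (set_val a) by exact: set_valP.
split=> [mA U oU | mA U oU].
  pose U' n := [set set_val @^-1` B | B in U n] : set (set (set_type A)).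
  have /mA[V [fV [_ cV]]] : forall n, open_cover (U' n).
    move=> n; have [oUn cUn] := oU n; split.
      by move=> _ [B UB <-]; exists B => //; exact: oUn.
    rewrite -subTset => a _; have [B UB Ba] := cUn _ (valA a).
    by exists (set_val @^-1` B) => //; exists B.
  (* Each selected trace is lifted back to a member of [U n]; the index [n] is kept because one
     trace may come from several covers. [set0] is a dummy value for unselected pairs. *)
  have /choice[g gP] : forall p : nat * set (set_type A),
      exists B : set T, V p.1 p.2 -> U p.1 B /\ set_val @^-1` B = p.2.
    move=> [n C] /=; have [VC|nVC] := pselect (V n C); last by exists set0.
    by have [B UB BC] := (fV n).1 _ VC; exists B.
  exists (fun n => [set g (n, C) | C in V n]); split.
    move=> n; split; last exact: finite_image (fV n).2.
    by move=> _ [C VC <-]; have [] := gP (n, C) VC.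
  move=> a Aa.
  have [C [n _ VC] Ca] : (\bigcup_(C in \bigcup_n V n) C)
      (exist _ a (mem_set Aa) : set_type A) by rewrite cV.
  exists n => //; exists (g (n, C)); first by exists C.
  have [_ /= eC] := gP (n, C) VC.
  by move: Ca; rewrite -[in X in X -> _]eC.
(* Admitting every open set whose trace lies in [U n] makes the traces of a selection fall back into
   [U n]. *)
pose U' n := [set B : set T | open B /\ U n (set_val @^-1` B)].
have /mA[V [fV cV]] : forall n, U' n `<=` open /\ A `<=` \bigcup_(B in U' n) B.
  move=> n; have [oUn cUn] := oU n; split=> [B []//|a Aa].
  have [C UC Ca] : (\bigcup_(C in U n) C)
      (exist _ a (mem_set Aa) : set_type A) by rewrite cUn.
  by have [B oB eB] := oUn _ UC; exists B; [split; rewrite ?eB|rewrite -eB in Ca].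
pose V' n := [set set_val @^-1` B | B in V n] : set (set (set_type A)).
have VU n : V' n `<=` U n by move=> _ [B VB <-]; exact: ((fV n).1 _ VB).2.
exists V'; split=> [n|]; first by split=> //; exact: finite_image (fV n).2.
split=> [C [n _ VC]|]; first by apply: (oU n).1; exact: VU.
rewrite -subTset => a _; have [n _ [B VB Ba]] := cV _ (valA a).
by exists (set_val @^-1` B) => //; exists n => //; exists B.
Qed.

(** Compactness enters as the near-covering property, for the filter along which [W] shrinks and [D]
    grows. Slices inside a single member serve the star argument, and finiteness of [D] the Menger
    property of products. *)
Lemma compact_tube (X Y : topologicalType) (x : X) (K : set Y)
    (U : set (set (X * Y))) :
  compact K -> U `<=` open -> [set x] `*` K `<=` \bigcup_(B in U) B ->
  exists W : set X, exists D : set (set (X * Y)),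
    [/\ open_nbhs x W, D `<=` U, finite_set D &
        forall y, K y -> exists2 B, D B & W `*` [set y] `<=` B].
Proof.
move=> /compact_near_coveringP cK oU cU.
pose base := [set p : set X * set (set (X * Y)) |
  [/\ open_nbhs x p.1, p.2 `<=` U & finite_set p.2]].
pose above (p : set X * set (set (X * Y))) :=
  [set q : set X * set (set (X * Y)) | q.1 `<=` p.1 /\ p.2 `<=` q.2].
have FF : Filter (filter_from base above).
  apply: filter_from_filter.
    by exists (setT, set0); split=> //; split=> //; exact: openT.
  move=> [W1 D1] [W2 D2] [/= W1x D1U fD1] [/= W2x D2U fD2].
  exists (W1 `&` W2, D1 `|` D2).
    split=> /=; [exact: open_nbhsI| |by rewrite finite_setU].
    by move=> B [/D1U|/D2U].
  move=> [W D] [/= WW DD]; split; split=> //= z.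
  - by move/WW => [].
  - by move=> D1z; apply: DD; left.
  - by move/WW => [].
  - by move=> D2z; apply: DD; right.
pose P (p : set X * set (set (X * Y))) (y : Y) :=
  exists2 B, p.2 B & p.1 `*` [set y] `<=` B.
have /(cK _ _ P FF) : forall y, K y ->
    \forall y' \near y & p \near filter_from base above, P p y'.
  move=> y Ky; have [B UB Bxy] : (\bigcup_(B in U) B) (x, y) by exact: cU.
  have /= : nbhs (x, y) B by apply: open_nbhs_nbhs; split=> //; exact: oU.
  move=> [[Q R] [/= Qx Ry] QRB].
  move: Qx; rewrite nbhsE => -[W Wx WQ].
  exists (R, above (W, [set B])).
    split=> //=; exists (W, [set B]) => //; split=> //= C -> //.
  move=> [y' [W' D']] [/= Ry' [/= W'W BD]]; exists B; first exact: BD.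
  by move=> [a b] [/= W'a ->]; apply: QRB; split=> //=; exact/WQ/W'W.
(* The pair [(W, D)] lies in its own [above] set, so [P] holds for it at every point of [K]. *)
move=> [[W D] [/= Wx DU fD] WDP]; exists W, D; split=> // y Ky.
by apply: (WDP (W, D)) Ky; split.
Qed.

(** The Menger property of [M] is applied to the bases of tubes over [K] covered by finitely many
    members of [U n]; finitely many tubes then use finitely many members. *)
Lemma menger_setM_compact (X Y : topologicalType) (M : set X) (K : set Y) :
  menger_set M -> compact K -> menger_set (M `*` K).
Proof.
move=> mM cK U oU.
pose tube n (W : set X) (D : set (set (X * Y))) :=
  [/\ open W, D `<=` U n, finite_set D & W `*` K `<=` \bigcup_(B in D) B].
pose W n := [set A : set X | exists D, tube n A D].
have /mM[V [fV cV]] : forall n, W n `<=` open /\ M `<=` \bigcup_(A in W n) A.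
  move=> n; have [oUn cUn] := oU n; split=> [A [D []]//|x Mx].
  have [|A [D [[oA Ax] DU fD AD]]] := compact_tube X Y x K (U n) cK oUn.
    by move=> [a y] [/= -> Ky]; exact: cUn.
  exists A => //; exists D; split=> // -[a y] [/= Aa Ky].
  by have [B DB AB] := AD _ Ky; exists B => //; exact: AB.
have /choice[D DP] : forall p : nat * set X, exists D, V p.1 p.2 -> tube p.1 p.2 D.
  move=> [n A] /=; have [VA|nVA] := pselect (V n A); last by exists set0.
  by have [D DP] := (fV n).1 _ VA; exists D.
exists (fun n => \bigcup_(A in V n) D (n, A)); split.
  move=> n; split; first by move=> B [A VA]; have [_ + _ _] := DP (n, A) VA; exact.
  by apply: bigcup_finite (fV n).2 _ => A VA; have [] := DP (n, A) VA.
move=> [x y] [/= Mx Ky]; have [n _ [A VA Ax]] := cV _ Mx.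
have [_ _ _ AK] := DP (n, A) VA; have [|B DB Bxy] := AK (x, y); first by split.
by exists n => //; exists B => //; exists A.
Qed.

Lemma menger_set_bigcup (T : topologicalType) (A : nat -> set T) :
  (forall k, menger_set (A k)) -> menger_set (\bigcup_k A k).
Proof.
move=> mA U oU.
(* The cover of index [n] serves [A k] for [k <= n] only, so that finitely many
   finite subfamilies are chosen from it. *)
have /choice[V VP] : forall k, exists V : nat -> set (set T),
    (forall n, V n `<=` U (n + k) /\ finite_set (V n)) /\
    A k `<=` \bigcup_n \bigcup_(B in V n) B.
  move=> k; apply: (mA k (fun n => U (n + k))) => n.
  have [oUn cUn] := oU (n + k); split=> // x Akx; apply: cUn.
  by exists k.
exists (fun n => \bigcup_(k in `I_n.+1) V k (n - k)); split.
  move=> n; split; last by apply: bigcup_finite => // k _; exact: ((VP k).1 _).2.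
  move=> B [k /= kn VB]; have := ((VP k).1 _).1 _ VB.
  by rewrite subnK.
move=> x [k _ /(VP k).2[n _ [B VB Bx]]]; exists (n + k) => //; exists B => //.
by exists k; rewrite /= ?addnK// ltnS leq_addl.
Qed.

(** Countably many open sets with sigma-compact closures cover [Y], hence so do the compact pieces
    of these closures. *)
Lemma lindelof_sigma_compact (Y : topologicalType) :
  lindelof_space Y -> locally_sigma_compact Y -> sigma_compact [set: Y].
Proof.
move=> lY scY.
have [|V [VU [ctV [_ cV]]]] :=
    lY [set V : set Y | open V /\ sigma_compact (closure V)].
  split=> [V []//|]; rewrite -subTset => y _.
  by have [V [[oV Vy] sV]] := scY y; exists V.
have /choice[K KP] : forall B : set Y, exists K : nat -> set Y,
    V B -> (forall n, compact (K n)) /\ closure B = \bigcup_n K n.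
  move=> B; have [VB|nVB] := pselect (V B); last by exists (fun=> set0).
  by have [_ [K KP]] := VU _ VB; exists K.
pose C := \bigcup_(B in V) range (K B).
have ctC : countable C.
  by apply: bigcup_countable ctV _ => B _; exact: card_image_le.
have cC k : C k -> compact k.
  by move=> [B VB [n _ <-]]; exact: (KP B VB).1.
have YC y : exists2 k, C k & k y.
  have [B VB By] : (\bigcup_(B in V) B) y by rewrite cV.
  have [m _ Kmy] : (\bigcup_n K B n) y.
    by rewrite -(KP B VB).2; exact: subset_closure.
  by exists (K B m) => //; exists B => //; exists m.
(* Only a nonempty countable set is the image of a sequence; if [C] is empty, so is [Y]. *)
case/pfcard_geP : ctC => [C0|[f]].
  exists (fun=> set0); split=> [_|]; first exact: compact0.
  by apply/esym; rewrite -subTset => y _; have [k] := YC y; rewrite C0.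
exists f; split=> [n|]; first by apply: cC; exact: funS.
apply/esym; rewrite -subTset => y _; have [k Ck ky] := YC y.
have [n _ fn] := @surj _ _ _ _ f k Ck.
by exists n => //; rewrite fn.
Qed.

Theorem proposition4p11 (X Y : topologicalType)
  (regX : regular_space X) (T1X : accessible_space X)
  (regY : regular_space Y) (T1Y : accessible_space Y)
  (smX : star_menger_space X) (lindY : lindelof_space Y)
  (locY : locally_compact [set: Y] \/ locally_sigma_compact Y) :
  star_menger_space (X * Y)%type.
Proof.
have {locY} scY : locally_sigma_compact Y.
  case: locY => // /locally_compactP lcY y; have [V [Vy cV]] := lcY y.
  exists V; split=> //; exists (fun=> closure V); split=> //.
  by rewrite bigcup_const.
have [K [cK YK]] := lindelof_sigma_compact Y lindY scY.
move=> U [oU cU].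
have /choice[M MP] : forall n, exists M : set X, menger_set M /\
    [set: X] `*` K n `<=` star (M `*` K n) U.
  move=> n; pose W := [set A : set X | open A /\
    forall y, K n y -> exists2 B, U B & A `*` [set y] `<=` B].
  have /smX[M [/menger_setP mM sM]] : open_cover W.
    split=> [A []//|]; rewrite -subTset => x _.
    have [|A [D [[oA Ax] DU _ AD]]] := compact_tube X Y x (K n) U (cK n) oU.
      by rewrite cU.
    exists A => //; split=> // y /AD[B DB AB]; exists B => //; exact: DU.
  exists M; split=> // -[x y] [/= _ Ky].
  (* Since [x] and [m] share [A], the points [(x, y)] and [(m, y)] share one member of [U]. *)
  have [A [[_ AP] [m [Am Mm]]] Ax] : star M W x by rewrite sM.
  have [B UB AB] := AP _ Ky; exists B; last exact: AB.
  by split=> //; exists (m, y); split; [exact: AB|].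
exists (\bigcup_n (M n `*` K n)); split.
  apply/menger_setP/menger_set_bigcup => n.
  by apply: menger_setM_compact (cK n); have [] := MP n.
rewrite -subTset => -[x y] _.
have [n _ Ky] : (\bigcup_n K n) y by rewrite -YK.
have [|B [UB [z [Bz MKz]]] Bxy] := (MP n).2 (x, y); first by split.
by exists B => //; split=> //; exists z; split=> //; exists n.
Qed.
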